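(* There exists an absolute constant $c$ such that for every graph $G$ of treewidth at most $2$ and every pair of proper $5$-colorings $\alpha,\beta$ of $G$, there exists a transformation from $\alpha$ to $\beta$ (a sequence of proper $5$-colorings, each obtained from the previous one by changing the color of exactly one vertex) in which each vertex of $G$ is recolored at most $c$ times.
   Context: A proper $k$-coloring of $G$ is a map $\sigma:V(G)\to\{1,\dots,k\}$ with $\sigma(x)\neq\sigma(y)$ for every edge $xy$. Two $k$-colorings are adjacent if they differ on exactly one vertex; a transformation is a walk between colorings in this adjacency relation, and a vertex is recolored once at each step where its color changes. *)

(* Defs.v *)
From mathcomp Require Import all_boot.
Set Implicit Arguments. Unset Strict Implicit. Unset Printing Implicit Defensive.

Definition simple_graph (V : finType) (e : rel V) : Prop :=
  symmetric e /\ irreflexive e.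

Definition n_arcs (V : finType) (e : rel V) : nat :=
  #|[set p : V * V | e p.1 p.2]|.

(* A tree on a nonempty finite node set: simple, connected, and with
   exactly |I| - 1 edges (i.e. 2(|I|-1) ordered arcs). *)
Definition is_tree (I : finType) (t : rel I) : Prop :=
  [/\ simple_graph t, 0 < #|I|,
      (forall i j : I, connect t i j) &
      n_arcs t = 2 * (#|I| - 1)].

Definition induced_connected (I : finType) (t : rel I) (S : {set I}) : Prop :=
  forall i j, i \in S -> j \in S ->
    connect (fun x y => [&& t x y, x \in S & y \in S]) i j.

Definition tree_decomposition (V I : finType) (e : rel V) (t : rel I)
    (B : I -> {set V}) : Prop :=
  [/\ is_tree t,
      (forall v : V, exists i, v \in B i),
      (forall u v : V, e u v -> exists i, (u \in B i) && (v \in B i)) &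
      (forall v : V, induced_connected t [set i | v \in B i])].

Definition treewidth_le (V : finType) (e : rel V) (k : nat) : Prop :=
  exists (I : finType) (t : rel I) (B : I -> {set V}),
    tree_decomposition e t B /\ forall i, #|B i| <= k.+1.

Definition coloring (V : finType) (k : nat) := {ffun V -> 'I_k}.

Definition proper_col (V : finType) (e : rel V) (k : nat) (f : coloring V k) : bool :=
  [forall x, forall y, e x y ==> (f x != f y)].

Definition adj_col (V : finType) (k : nat) (f g : coloring V k) : bool :=
  #|[set x | f x != g x]| == 1.

Definition recolor_count (V : finType) (k : nat) (v : V) (s : seq (coloring V k)) : nat :=
  count (fun p : coloring V k * coloring V k => p.1 v != p.2 v) (zip s (behead s)).

(* Main.v *)
Require Import Defs.
From mathcomp Require Import all_boot.

Set Implicit Arguments. Unset Strict Implicit. Unset Printing Implicit Defensive.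

(** A sweep recolors the vertices along a perfect elimination ordering of a chordal
    completion H of G, youngest first, each vertex x at most once from f x to g x;
    it is legal as soon as g x avoids f u, g u, f w, g w for the at most two older
    neighbors u, w of x in H.  These are at most four colors, so a first sweep makes
    the coloring proper on H.  Let the classes 0, 1, 2 be those of a 3-coloring of H:
    the classes 1 and 2 induce a forest.  Choosing for each vertex, older vertices
    first, the colors it takes during five further sweeps, one can expel color 0 from
    the forest: whether the choice can be continued depends only on the trajectories
    of the two older neighbors, and a finite computation shows that it can.  Then
    class 0 moves to color 0, the forest is recolored with the four other colors,
    and every coloring ends, after nine recolorings per vertex, in the same
    3-coloring of H. *)

(** * Recoloring walks *)

Section Walks.
Variables (V : finType) (e : rel V) (k : nat).
Implicit Types (f g h : coloring V k) (s : seq (coloring V k)).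

Definition recolorable (n : nat) f g : Prop :=
  exists s, [/\ path (@adj_col V k) f s, all (fun f => proper_col e f) s,
                last f s = g & forall v, recolor_count v (f :: s) <= n].

Lemma recolor_count_cons v f g s :
  recolor_count v [:: f, g & s] = (f v != g v) + recolor_count v (g :: s).
Proof. by []. Qed.

Lemma recolor_count_cat v f s1 s2 :
  recolor_count v (f :: s1 ++ s2) =
  recolor_count v (f :: s1) + recolor_count v (last f s1 :: s2).
Proof.
elim: s1 f => [|g s1 IH] f; first by rewrite {2}/recolor_count.
by rewrite cat_cons !recolor_count_cons IH addnA.
Qed.

Lemma recolorable_refl f : recolorable 0 f f.
Proof. by exists [::]; split. Qed.

Lemma recolorable_trans m n f g h :
  recolorable m f g -> recolorable n g h -> recolorable (m + n) f h.
Proof.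
case=> s1 [p1 a1 l1 c1] [s2 [p2 a2 l2 c2]]; exists (s1 ++ s2); split.
- by rewrite cat_path p1 l1.
- by rewrite all_cat a1.
- by rewrite last_cat l1.
- by move=> v; rewrite recolor_count_cat l1 leq_add.
Qed.

Lemma adj_col_sym f g : adj_col f g = adj_col g f.
Proof.
by rewrite /adj_col; congr (#|pred_of_set _| == 1); apply/setP=> x; rewrite !inE eq_sym.
Qed.

(** [recolorable] tests only the colorings after the first, so [f], which becomes the last coloring
    of the reversed walk, is assumed proper. *)
Lemma recolorable_sym n f g :
  proper_col e f -> recolorable n f g -> recolorable n g f.
Proof.
move=> pf [s [ps als ls cs]].
suff [t [pt alt lt ct]] : exists t,
    [/\ path (@adj_col V k) g t, all (fun f => proper_col e f) t, last g t = f &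
        forall v, recolor_count v (g :: t) = recolor_count v (f :: s)].
  by exists t; split=> // v; rewrite ct.
elim: s f pf ps als ls {cs} => [|f1 s IH] f pf /=; first by move=> _ _ <-; exists [::].
case/andP=> af ps /andP[pf1 als] ls.
have [t [pt alt lt ct]] := IH f1 pf1 ps als ls.
exists (rcons t f); split.
- by rewrite rcons_path pt lt adj_col_sym.
- by rewrite all_rcons pf.
- by rewrite last_rcons.
- move=> v; rewrite -cats1 recolor_count_cat ct lt !recolor_count_cons.
  by rewrite {2}/recolor_count /= addn0 addnC eq_sym.
Qed.

Lemma proper_colP f : reflect (forall x y, e x y -> f x != f y) (proper_col e f).
Proof.
apply: (iffP forallP) => [H x y | H x]; first by move/forallP: (H x) => /(_ y)/implyP.
by apply/forallP => y; apply/implyP/H.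
Qed.

(* The vertices are recolored by decreasing rank: when u moves, its younger
   neighbors already have their new color and its older ones their old color. *)
Lemma recolorable_sweep (r : V -> nat) f g :
  injective r -> symmetric e -> irreflexive e -> proper_col e f ->
  (forall u x, r u < r x -> e u x -> (g x != f u) && (g x != g u)) ->
  recolorable 1 f g.
Proof.
move=> rI eS eI pf sw.
(* In [m n] exactly the vertices of rank at least [n] have moved: the walk descends from [m N],
   which is [f], to [m 0], which is [g]. *)
pose m n : coloring V k := [ffun v => if r v < n then f v else g v].
have mP n : proper_col e (m n).
  apply/proper_colP=> x y; wlog lt_xy : x y / r x < r y.
    move=> W exy; case: (ltngtP (r x) (r y)) => [/W||/rI E]; first exact.
      by rewrite eq_sym eS in exy *; move/W; apply.
    by rewrite E eI in exy.
  move=> exy; case/andP: (sw _ _ lt_xy exy) => n1 n2.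
  rewrite !ffunE; case: (ltnP (r y) n) => [lt_yn|_].
    by rewrite (ltn_trans lt_xy lt_yn); apply: (proper_colP f pf).
  by case: ifP; rewrite eq_sym.
have [N ltN] : exists N, forall v, r v < N.
  by exists (\max_v r v).+1 => v; rewrite ltnS; apply: leq_bigmax.
have mN : m N = f by apply/ffunP=> v; rewrite ffunE ltN.
suff [s [ps als ls cs]] : exists s, [/\ path (@adj_col V k) (m N) s,
    all (fun f => proper_col e f) s, last (m N) s = g &
    forall v, recolor_count v (m N :: s) <= (r v < N)].
  by exists s; rewrite -mN; split=> // v; apply: leq_trans (cs v) (leq_b1 _).
elim: N {ltN mN} => [|n [s [ps als ls cs]]].
  exists [::]; split=> //=; apply/ffunP=> v; by rewrite ffunE.
have step v : (m n.+1 v != m n v) = (r v == n) && (f v != g v).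
  rewrite !ffunE ltnS leq_eqVlt; by case: (ltngtP (r v) n) => _ /=; rewrite ?eqxx.
have cnt v : (m n.+1 v != m n v) + (r v < n) <= (r v < n.+1).
  by rewrite step ltnS; case: (ltngtP (r v) n) => _ //=; rewrite addn0 leq_b1.
(* If no vertex of rank [n] changes color, the step is skipped, since adjacency requires a
   change. *)
case: (boolP [exists v, m n.+1 v != m n v]) => [/existsP[v nv]|].
  exists (m n :: s); split=> //=.
  - rewrite ps andbT /adj_col; apply/cards1P; exists v; apply/setP=> w; rewrite !inE.
    apply/idP/eqP=> [|->//]; rewrite !step in nv *.
    by case/andP: nv => /eqP rv _ /andP[/eqP rw _]; apply: rI; rewrite rv rw.
  - by rewrite mP.
  - by move=> w; rewrite recolor_count_cons; apply: leq_trans (cnt w); rewrite leq_add2l.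
rewrite negb_exists => /forallP E.
have -> : m n.+1 = m n by apply/ffunP=> v; move: (E v); rewrite negbK => /eqP.
exists s; split=> // v; apply: leq_trans (cs v) _; apply: leq_trans (cnt v); exact: leq_addl.
Qed.

End Walks.

(** * Elimination orderings *)

(** The parent [p i] is a neighbor closer to the root. The |I| - 1 arcs to parents and their
    reverses exhaust the arcs counted by [n_arcs], so every edge joins a node to its parent. *)
Lemma tree_rooting (I : finType) (t : rel I) : is_tree t ->
  exists (r : I) (p : I -> I) (d : I -> nat),
    [/\ p r = r, forall i, i != r -> d (p i) < d i &
    forall i j, t i j -> (i != r /\ j = p i) \/ (j != r /\ i = p j)].
Proof.
case=> -[tS tI] /card_gt0P[r _] conn arcs.
pose P i n := [exists q : n.-tuple I, path t r q && (last r q == i)].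
have exP i : exists n, P i n.
  have /connectP[q pq ->] := conn r i; exists (size q); apply/existsP.
  by exists (in_tuple q); rewrite pq eqxx.
pose d i := ex_minn (exP i).
pose p i := odflt r [pick j | t i j && (d j < d i)].
have pP i : i != r -> t i (p i) && (d (p i) < d i).
  move=> ir; rewrite /p; case: pickP => //= none.
  rewrite /d in none; case: (ex_minnP (exP i)) none => n /existsP[[q /=]].
  case/lastP: q => [|q j] /eqP <-; first by case/andP=> _ /eqP E; rewrite -E eqxx in ir.
  rewrite rcons_path last_rcons => /andP[/andP[pq tj] /eqP ji] _ /(_ (last r q)).
  rewrite tS -ji tj size_rcons /=; case: ex_minnP => m _ /(_ (size q)).
  rewrite /P ltnS => -> //; apply/existsP; by exists (in_tuple q); rewrite pq eqxx.
exists r, p, d; split=> [|i /pP/andP[] //|].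
  have dr : d r = 0.
    apply/eqP; rewrite -leqn0 /d; case: ex_minnP => n _; apply.
    by apply/existsP; exists [tuple] => /=.
  by rewrite /p; case: pickP => //= j; rewrite dr andbF.
pose A1 := [set (i, p i) | i in [set~ r]]; pose A2 := [set (p i, i) | i in [set~ r]].
have c1 : #|A1| = #|I| - 1 by rewrite card_imset ?cardsC1 ?subn1 // => i j [].
have c2 : #|A2| = #|I| - 1 by rewrite card_imset ?cardsC1 ?subn1 // => i j [].
have dis : A1 :&: A2 = set0.
  apply/setP=> -[i j]; rewrite !inE; apply/negP => /andP[/imsetP[a]].
  rewrite !inE => /pP/andP[_ la] [-> ->] /imsetP[b]; rewrite !inE => /pP/andP[_ lb] [E1 E2].
  by move: la lb; rewrite E2 -E1 => /ltn_trans h /h; rewrite ltnn.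
have sub : A1 :|: A2 \subset [set q : I * I | t q.1 q.2].
  apply/subsetP=> q; rewrite !inE => /orP[] /imsetP[i]; rewrite !inE => /pP/andP[ti _] -> //=.
  by rewrite tS.
have E : A1 :|: A2 = [set q : I * I | t q.1 q.2].
  apply/eqP; rewrite eqEcard sub cardsU dis cards0 subn0 c1 c2 addnn -mul2n.
  by rewrite -arcs leqnn.
move=> i j tij; have : (i, j) \in A1 :|: A2 by rewrite E inE.
rewrite inE => /orP[] /imsetP[a]; rewrite !inE => ar [-> ->]; by [left | right].
Qed.

(* A perfect elimination ordering read backwards: r is the rank, and the older
   vertices, those of smaller rank, are eliminated last. *)
Definition elimination_order (V : finType) (k : nat) (r : V -> nat) (h : rel V) : Prop :=
  [/\ injective r, symmetric h,
      forall x, #|[set u | h u x && (r u < r x)]| <= k &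
      forall x u w, h u x -> h w x -> r u < r x -> r w < r x -> u != w -> h u w].

(** [h] joins vertices sharing a bag, and vertices are ranked by the depth of their topmost bag. The
    older neighbors of [x] all lie in the topmost bag of [x], hence are pairwise adjacent and at
    most [k] in number. *)
Lemma treewidth_elimination_order (V : finType) (e : rel V) (k : nat) :
  irreflexive e -> treewidth_le e k ->
  exists (r : V -> nat) (h : rel V), elimination_order k r h /\ subrel e h.
Proof.
move=> eI [I [t [B [[tree Bv Be Bc] Bk]]]].
have [rt [p [d [prt dp tp]]]] := tree_rooting tree.
have topP v : exists i, (v \in B i) && [forall j, (v \in B j) ==> (d i <= d j)].
  have [i0 vi0] := Bv v; case: (@arg_minnP _ i0 (fun i => v \in B i) d vi0) => i vi mi.
  by exists i; rewrite vi; apply/forallP=> j; apply/implyP/mi.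
pose top v := xchoose (topP v).
have topB v : v \in B (top v) by case/andP: (xchooseP (topP v)).
have topm v j : v \in B j -> d (top v) <= d j.
  by case/andP: (xchooseP (topP v)) => _ /forallP/(_ j)/implyP.
have desc_d i j : fconnect p j i -> (j == i) || (d i < d j).
  case/connectP=> q; elim: q j => [|a q IH] j /=; first by move=> _ ->; rewrite eqxx.
  case/andP=> /eqP <- pq /(IH _ pq).
  have [->|/dp lt] := eqVneq j rt; first by rewrite prt.
  by case/orP=> [/eqP<-|H]; rewrite ?lt ?(ltn_trans H lt) orbT.
(* If the bag above i missed v, all bags of v would be descendants of i. *)
have up v i : v \in B i -> i != top v -> (i != rt) && (v \in B (p i)).
  move=> vi itop; apply/negPn/negP=> npi.
  suff /desc_d/orP[/eqP E|] : fconnect p (top v) i; first by rewrite E eqxx in itop.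
    by rewrite ltnNge topm.
  have /connectP[q pq ->] := Bc v i (top v) ltac:(by rewrite inE) ltac:(by rewrite inE topB).
  elim/last_ind: q pq => [|q j IH]; first by rewrite connect0.
  rewrite rcons_path last_rcons => /andP[/IH cl /and3P[tl]]; rewrite !inE => vl vj.
  case: (tp _ _ tl) => [[lr jE]|[_ lE]]; last first.
    by apply: connect_trans cl; rewrite lE fconnect1.
  rewrite jE; have [li|li] := eqVneq (last i q) i.
    by case/negP: npi; rewrite -li lr -jE vj.
  case/connectP: cl => -[|a q'] /=; first by move=> _ E; rewrite -E eqxx in li.
  by case/andP=> /eqP -> pq' ->; apply/connectP; exists q'.
(* One climbs from the common bag to the topmost bag of [x]; [u] cannot drop out earlier, its own
   topmost bag being no deeper. *)
have share u x i : u \in B i -> x \in B i -> d (top u) <= d (top x) -> u \in B (top x).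
  have [n] := ubnP (d i); elim: n i => // n IH i; rewrite ltnS => din ui xi le.
  have [<- //|ix] := eqVneq i (top x).
  case/andP: (up _ _ xi ix) => ir xpi; have dpi := dp _ ir.
  have [iu|iu] := eqVneq i (top u).
    by have := leq_ltn_trans (topm _ _ xpi) dpi; rewrite {1}iu ltnNge le.
  case/andP: (up _ _ ui iu) => _ upi.
  exact: IH (leq_trans dpi din) upi xpi le.
(* Depth is the leading digit in base [#|V|]; [enum_rank] breaks ties. *)
pose r x := d (top x) * #|V| + enum_rank x.
pose h u v := (u != v) && [exists i, (u \in B i) && (v \in B i)].
have rlt u x : r u < r x -> d (top u) <= d (top x).
  move=> lt; rewrite leqNgt; apply/negP=> dlt; move: lt; rewrite ltnNge => /negP; apply; rewrite /r.
  apply: (@leq_trans ((d (top x)).+1 * #|V|)); first by rewrite mulSn addnC leq_add2r ltnW.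
  by apply: leq_trans (leq_addr _ _); rewrite leq_mul2r dlt orbT.
have older u x : h u x -> r u < r x -> u \in B (top x).
  by case/andP=> _ /existsP[i /andP[ui xi]] /rlt; apply: share ui xi.
exists r, h; split; last first.
  move=> u v uv; apply/andP; split; first by apply: contraTneq uv => ->; rewrite eI.
  by apply/existsP; apply: Be.
split.
- move=> u v E; apply: enum_rank_inj; apply: val_inj => /=.
  have m w : r w = enum_rank w %[mod #|V|] by rewrite /r modnMDl.
  by move: (m u); rewrite E m !modn_small.
- move=> u v; rewrite /h eq_sym; congr andb; apply: eq_existsb => i; exact: andbC.
- move=> x; rewrite -ltnS; apply: leq_trans (Bk (top x)).
  rewrite (cardsD1 x (B (top x))) topB add1n ltnS; apply: subset_leq_card.
  apply/subsetP=> u; rewrite !inE => /andP[hux rux]; rewrite (older _ _ hux rux) andbT.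
  by case/andP: hux.
- move=> x u w hu hw ru rw uw; rewrite /h uw; apply/existsP; exists (top x).
  by rewrite !older.
Qed.

(** Greedy choice of states by increasing rank. Two older neighbors of a vertex are themselves
    adjacent, so their states may be assumed [good] for each other. *)
Lemma older_first_choice (V : finType) (r : V -> nat) (h : rel V) (S : Type)
    (ok : V -> S -> Prop) (good : S -> S -> Prop) :
  elimination_order 2 r h ->
  (forall x, exists s, ok x s) ->
  (forall u x a, h u x -> r u < r x -> ok u a -> exists2 s, ok x s & good a s) ->
  (forall u w x a b, h u w -> h u x -> h w x -> r u < r w -> r w < r x ->
     ok u a -> ok w b -> good a b -> exists s, [/\ ok x s, good a s & good b s]) ->
  exists f : V -> S, (forall x, ok x (f x)) /\
    forall u x, h u x -> r u < r x -> good (f u) (f x).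
Proof.
move=> [rI hS h2 hc] E0 E1 E2.
suff H n : exists f : V -> S, (forall x, ok x (f x)) /\
    forall u x, r x < n -> h u x -> r u < r x -> good (f u) (f x).
  have [f [fok fgood]] := H (\max_v r v).+1; exists f; split=> // u x.
  by apply: fgood; rewrite ltnS; apply: leq_bigmax.
elim: n => [|n [f [fok fgood]]].
  by have [f fok] := fin_all_exists E0; exists f.
case: (pickP [pred x | r x == n]) => [x /eqP rx|none]; last first.
  exists f; split=> // u x; rewrite ltnS leq_eqVlt; case/orP=> [rx|]; last exact: fgood.
  by move: (none x); rewrite /= rx.
suff [s sok sgood] : exists2 s, ok x s & forall u, h u x -> r u < n -> good (f u) s.
  exists (fun v => if v == x then s else f v); split=> [v|u v].
    by case: eqP => [->|].
  rewrite ltnS leq_eqVlt => rv huv ruv.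
  have ux : u == x = false.
    by apply/negbTE; apply: contraTneq ruv => ->; rewrite rx -leqNgt leq_eqVlt.
  rewrite ux; have [vx|vx] := eqVneq v x; first by rewrite vx in huv ruv; apply: sgood; rewrite -?rx.
  case/orP: rv => [/eqP rv|rv]; last exact: fgood.
  by case/eqP: vx; apply: rI; rewrite rv.
pose N := [set u | h u x && (r u < r x)].
have mN u : (u \in enum N) = h u x && (r u < n) by rewrite mem_enum inE rx.
have sN : size (enum N) <= 2 by rewrite -cardE; apply: h2.
have uN : uniq (enum N) := enum_uniq _.
case: (enum N) mN sN uN => [|u [|w []]] // mN _ uN.
- by have [s sok] := E0 x; exists s => // u hu ru; move: (mN u); rewrite hu ru.
- have /andP[hu ru] : h u x && (r u < n) by rewrite -mN inE.
  have [|s sok sg] := E1 u x (f u) hu _ (fok u); first by rewrite rx.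
  by exists s => // v hv rv; move: (mN v); rewrite hv rv inE => /eqP ->.
(* [good] is directed from older to younger, so the two neighbors are sorted by rank. *)
wlog lt_uw : u w mN uN / r u < r w => [W|].
  have uw : u != w by move: uN; rewrite /= !inE andbT.
  case: (ltngtP (r u) (r w)) => [lt|lt|/rI E]; last by rewrite E eqxx in uw.
    exact: (W u w).
  by apply: (W w u) => // [v|]; rewrite ?mN // -?mN ?inE /= ?inE ?andbT ?orbF 1?orbC // eq_sym.
have /andP[hu ru] : h u x && (r u < n) by rewrite -mN inE eqxx.
have /andP[hw rw] : h w x && (r w < n) by rewrite -mN !inE eqxx orbT.
have uw : u != w by move: uN; rewrite /= !inE andbT.
have huw : h u w by apply: hc hu hw _ _ uw; rewrite rx.
have guw : good (f u) (f w) by apply: fgood.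
have [|s [sok sgu sgw]] := E2 u w x _ _ huw hu hw lt_uw _ (fok u) (fok w) guw; first by rewrite rx.
by exists s => // v hv rv; move: (mN v); rewrite hv rv !inE => /orP[]/eqP ->.
Qed.

(** * Trajectories of five sweeps *)

(* Trajectories are considered up to renaming of the colors 1, ..., 4: [pattern]
   relabels the colors other than 0 in order of first appearance. *)
Definition first_seen (s : seq nat) : seq nat := rev (undup (rev (0 :: s))).

Definition pattern (s : seq nat) : seq nat := [seq index c (first_seen s) | c <- s].

(* Certificate found by computer search.  [patterns true] lists trajectories for
   class 0 and [patterns false] those for the classes 1 and 2; [clashes] lists
   the concatenations of the pairs (older, younger) that the choice must avoid. *)
Definition patterns (k : bool) : seq (seq nat) :=
  if k then [::
    [:: 0; 0; 0; 0; 0; 0]; [:: 0; 0; 1; 1; 1; 1]; [:: 0; 1; 1; 1; 1; 1];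
    [:: 0; 1; 1; 2; 2; 2]; [:: 0; 1; 2; 2; 2; 2]; [:: 1; 0; 0; 0; 0; 0];
    [:: 1; 0; 2; 2; 2; 2]; [:: 1; 1; 0; 0; 0; 0]; [:: 1; 1; 1; 2; 2; 2];
    [:: 1; 1; 2; 1; 1; 1]; [:: 1; 1; 2; 2; 2; 2]; [:: 1; 2; 0; 0; 0; 0];
    [:: 1; 2; 2; 1; 1; 1]; [:: 1; 2; 2; 2; 1; 1]; [:: 1; 2; 2; 2; 2; 2];
    [:: 1; 2; 2; 2; 3; 3]; [:: 1; 2; 3; 3; 3; 3]]
  else [::
    [:: 0; 0; 0; 0; 0; 1]; [:: 0; 0; 1; 1; 1; 1]; [:: 0; 1; 1; 1; 1; 1];
    [:: 0; 1; 1; 2; 2; 2]; [:: 0; 1; 2; 2; 2; 2]; [:: 1; 0; 0; 0; 0; 1];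
    [:: 1; 0; 0; 0; 0; 2]; [:: 1; 0; 2; 2; 2; 2]; [:: 1; 1; 0; 0; 0; 2];
    [:: 1; 1; 1; 1; 1; 1]; [:: 1; 1; 1; 1; 2; 2]; [:: 1; 1; 2; 2; 2; 2];
    [:: 1; 2; 0; 0; 0; 3]; [:: 1; 2; 2; 1; 1; 1]; [:: 1; 2; 2; 2; 1; 1];
    [:: 1; 2; 2; 2; 2; 2]; [:: 1; 2; 2; 2; 3; 3]; [:: 1; 2; 3; 3; 3; 3]].

Definition clashes : seq (seq nat) := [::
  [:: 0; 1; 1; 2; 2; 2; 2; 3; 4; 4; 4; 4]; [:: 0; 1; 1; 2; 2; 2; 3; 4; 0; 0; 0; 0];
  [:: 0; 1; 1; 2; 2; 2; 3; 4; 0; 0; 0; 1]; [:: 0; 1; 2; 2; 2; 2; 1; 3; 4; 4; 4; 4];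
  [:: 0; 1; 2; 2; 2; 2; 2; 3; 4; 4; 4; 4]; [:: 0; 1; 2; 2; 2; 2; 3; 2; 4; 4; 4; 4];
  [:: 0; 1; 2; 2; 2; 2; 3; 4; 0; 0; 0; 0]; [:: 0; 1; 2; 2; 2; 2; 3; 4; 0; 0; 0; 1];
  [:: 1; 0; 0; 0; 0; 2; 2; 3; 4; 4; 4; 4]; [:: 1; 0; 2; 2; 2; 2; 0; 3; 4; 4; 4; 4];
  [:: 1; 0; 2; 2; 2; 2; 2; 3; 3; 3; 4; 4]; [:: 1; 0; 2; 2; 2; 2; 2; 3; 4; 4; 4; 4];
  [:: 1; 0; 2; 2; 2; 2; 3; 2; 4; 4; 4; 4]; [:: 1; 0; 2; 2; 2; 2; 3; 4; 1; 1; 1; 1];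
  [:: 1; 0; 2; 2; 2; 2; 3; 4; 4; 4; 1; 1]; [:: 1; 1; 0; 0; 0; 2; 2; 3; 4; 4; 4; 4];
  [:: 1; 2; 0; 0; 0; 0; 0; 3; 3; 4; 4; 4]; [:: 1; 2; 0; 0; 0; 0; 0; 3; 4; 4; 4; 4];
  [:: 1; 2; 0; 0; 0; 0; 2; 3; 4; 4; 4; 4]; [:: 1; 2; 0; 0; 0; 0; 3; 0; 4; 4; 4; 4];
  [:: 1; 2; 0; 0; 0; 0; 3; 4; 1; 1; 1; 1]; [:: 1; 2; 0; 0; 0; 0; 3; 4; 4; 4; 1; 1];
  [:: 1; 2; 0; 0; 0; 3; 0; 3; 3; 4; 4; 4]; [:: 1; 2; 0; 0; 0; 3; 0; 3; 4; 4; 4; 4];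
  [:: 1; 2; 0; 0; 0; 3; 2; 3; 4; 4; 4; 4]; [:: 1; 2; 0; 0; 0; 3; 2; 4; 1; 1; 1; 1];
  [:: 1; 2; 0; 0; 0; 3; 3; 0; 4; 4; 4; 4]; [:: 1; 2; 0; 0; 0; 3; 3; 4; 1; 1; 1; 1];
  [:: 1; 2; 0; 0; 0; 3; 3; 4; 4; 4; 1; 1]; [:: 1; 2; 0; 0; 0; 3; 3; 4; 4; 4; 2; 2];
  [:: 1; 2; 0; 0; 0; 3; 4; 3; 1; 1; 1; 1]; [:: 1; 2; 0; 0; 0; 3; 4; 3; 3; 3; 1; 1];
  [:: 1; 2; 2; 2; 3; 3; 3; 0; 4; 4; 4; 4]; [:: 1; 2; 2; 2; 3; 3; 3; 4; 0; 0; 0; 0];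
  [:: 1; 2; 2; 2; 3; 3; 3; 4; 0; 0; 0; 1]; [:: 1; 2; 2; 2; 3; 3; 3; 4; 0; 0; 0; 2];
  [:: 1; 2; 2; 2; 3; 3; 4; 0; 1; 1; 1; 1]; [:: 1; 2; 2; 2; 3; 3; 4; 3; 0; 0; 0; 1];
  [:: 1; 2; 3; 3; 3; 3; 0; 3; 4; 4; 4; 4]; [:: 1; 2; 3; 3; 3; 3; 0; 4; 1; 1; 1; 1];
  [:: 1; 2; 3; 3; 3; 3; 0; 4; 4; 1; 1; 1]; [:: 1; 2; 3; 3; 3; 3; 2; 0; 4; 4; 4; 4];
  [:: 1; 2; 3; 3; 3; 3; 2; 4; 0; 0; 0; 0]; [:: 1; 2; 3; 3; 3; 3; 2; 4; 0; 0; 0; 1];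
  [:: 1; 2; 3; 3; 3; 3; 3; 0; 4; 4; 4; 4]; [:: 1; 2; 3; 3; 3; 3; 3; 4; 0; 0; 0; 0];
  [:: 1; 2; 3; 3; 3; 3; 3; 4; 0; 0; 0; 1]; [:: 1; 2; 3; 3; 3; 3; 3; 4; 0; 0; 0; 2];
  [:: 1; 2; 3; 3; 3; 3; 4; 0; 0; 0; 0; 1]; [:: 1; 2; 3; 3; 3; 3; 4; 0; 1; 1; 1; 1];
  [:: 1; 2; 3; 3; 3; 3; 4; 3; 0; 0; 0; 0]; [:: 1; 2; 3; 3; 3; 3; 4; 3; 0; 0; 0; 1];
  [:: 1; 2; 3; 3; 3; 3; 4; 3; 0; 0; 0; 2]; [:: 1; 2; 3; 3; 3; 3; 4; 4; 0; 0; 0; 1]].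

Definition admissible (k : bool) (d : seq nat) : bool :=
  all (gtn 5) d && (pattern d \in patterns k).

(** An explicit list of what [admissible] tests, so that the checks below are exhaustive by
    computation. *)
Definition trajectories (k : bool) : seq (seq nat) :=
  undup [seq [seq nth 0 (0 :: l) c | c <- q]
        | q <- patterns k, l <- permutations [:: 1; 2; 3; 4]].

(* For d older than e: one sweep leads from d_t, e_t to d_(t+1), e_(t+1). *)
Definition compatible (d e : seq nat) : bool :=
  (nth 0 d 0 != nth 0 e 0) &&
  all (fun t => (nth 0 e t.+1 != nth 0 d t) && (nth 0 e t.+1 != nth 0 d t.+1)) (iota 0 5).

Definition good (d e : seq nat) : bool :=
  compatible d e && (pattern (d ++ e) \notin clashes).

(** Flags tell which vertices lie in class 0, and [c] is the prescribed initial color of the new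
    vertex. *)
Definition extends0 (k : bool) : bool :=
  let o := trajectories k in all (fun c => has (fun x => nth 0 x 0 == c) o) (iota 0 5).

Definition extends1 (k1 k2 : bool) : bool :=
  let o2 := trajectories k2 in
  all (fun d => all (fun c => (c == nth 0 d 0) ||
                     has (fun x => (nth 0 x 0 == c) && good d x) o2) (iota 0 5))
      (patterns k1).

(** Only [d] is normalized to a pattern: one renaming acts on all trajectories at once, so [e] and
    [x] range over complete lists. *)
Definition extends2 (k1 k2 k3 : bool) : bool :=
  let o2 := trajectories k2 in let o3 := trajectories k3 in
  all (fun d => let o3d := filter (good d) o3 in
    all (fun e => good d e ==>
      all (fun c => [|| c == nth 0 d 0, c == nth 0 e 0 |
                     has (fun x => (nth 0 x 0 == c) && good e x) o3d]) (iota 0 5))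
      o2) (patterns k1).

(** * Renaming of colors *)

Lemma first_seenE s : first_seen s = 0 :: rev [seq c <- undup (rev s) | c != 0].
Proof. by rewrite /first_seen rev_cons undup_rcons rev_rcons. Qed.

Lemma first_seen_cat s t : exists t', first_seen (s ++ t) = first_seen s ++ t'.
Proof. by eexists; rewrite /first_seen -cat_cons rev_cat undup_cat rev_cat. Qed.

Lemma mem_first_seen s c : (c \in first_seen s) = (c \in 0 :: s).
Proof. by rewrite /first_seen mem_rev mem_undup mem_rev. Qed.

Lemma pattern_map pi s : injective pi -> pi 0 = 0 -> pattern (map pi s) = pattern s.
Proof.
move=> piI pi0; have E : first_seen (map pi s) = map pi (first_seen s).
  by rewrite /first_seen -[0 in LHS]pi0 -map_cons -map_rev undup_map_inj // map_rev.
by rewrite /pattern E -map_comp; apply: eq_map => c /=; rewrite index_map.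
Qed.

Lemma pattern_inverse d : all (gtn 5) d ->
  exists2 l, perm_eq l [:: 1; 2; 3; 4] & d = [seq nth 0 (0 :: l) c | c <- pattern d].
Proof.
(* Appending 1, ..., 4 makes every color occur, so the list is 0 followed by a permutation, and
   [first_seen d] is a prefix of it. *)
move=> d5; have E := first_seenE (d ++ [:: 1; 2; 3; 4]).
set l := rev _ in E; exists l.
  apply: uniq_perm => [|//|c].
    by rewrite rev_uniq filter_uniq ?undup_uniq.
  rewrite mem_rev mem_filter mem_undup mem_rev mem_cat.
  case: (boolP (c \in d)) => [/(allP d5) /=|_]; first by case: c => [|[|[|[|[|]]]]].
  by case: c.
rewrite -E; have [t' ->] := first_seen_cat d [:: 1; 2; 3; 4].
rewrite -map_comp -[LHS]map_id; apply/eq_in_map => c cd /=.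
have cs : c \in first_seen d by rewrite mem_first_seen inE cd orbT.
by rewrite nth_cat index_mem cs nth_index.
Qed.

Lemma pattern_renaming d : all (gtn 5) d ->
  exists pi pi' : nat -> nat,
    [/\ cancel pi pi', cancel pi' pi, pi 0 = 0, forall c, (pi c < 5) = (c < 5) &
        map pi d = pattern d].
Proof.
move=> d5; have [l pl dE] := pattern_inverse d5; pose L := 0 :: l.
have uL : uniq L by rewrite (@perm_uniq _ _ [:: 0; 1; 2; 3; 4]) // perm_cons.
have mL c : (c \in L) = (c < 5).
  by rewrite (@perm_mem _ _ [:: 0; 1; 2; 3; 4]) ?perm_cons //; case: c => [|[|[|[|[|]]]]].
have sL : size L = 5 by rewrite /= (perm_size pl).
(* Extended by the identity, both maps are bijections of [nat], as the invariance lemmas require. *)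
pose pi c := if c < 5 then index c L else c; pose pi' c := if c < 5 then nth 0 L c else c.
have pi5 c : (pi c < 5) = (c < 5).
  by rewrite /pi; case: (boolP (c < 5)) => [|/negbTE] //; rewrite -mL -index_mem sL.
have K : cancel pi pi'.
  by move=> c; rewrite /pi' pi5 /pi; case: (boolP (c < 5)) => // c5; rewrite nth_index ?mL.
have K' : cancel pi' pi.
  move=> c; rewrite /pi' /pi; case: (boolP (c < 5)) => [c5|/negbTE -> //].
  by rewrite -mL mem_nth ?sL // index_uniq ?sL.
exists pi, pi'; split=> //.
have p5 : all (gtn 5) (pattern d).
  apply/allP=> _ /mapP[c cd ->] /=; rewrite -sL.
  have : index c (first_seen d) < size (first_seen d) by rewrite index_mem mem_first_seen inE cd orbT.
  move/leq_trans; apply; rewrite uniq_leq_size ?rev_uniq ?undup_uniq // => x.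
  by rewrite mem_first_seen inE mL => /orP[/eqP->//|/(allP d5)].
rewrite {1}dE -map_comp -[RHS]map_id; apply/eq_in_map => c /(allP p5) /= c5.
by rewrite -[RHS]K' /pi' c5.
Qed.

Lemma nth_map0 (pi : nat -> nat) s t : pi 0 = 0 -> nth 0 (map pi s) t = pi (nth 0 s t).
Proof.
move=> pi0; have [lt|ge] := ltnP t (size s); first by rewrite (nth_map 0).
by rewrite !nth_default ?size_map ?pi0.
Qed.

Lemma good_map pi d e : injective pi -> pi 0 = 0 -> good (map pi d) (map pi e) = good d e.
Proof.
move=> piI pi0; rewrite /good /compatible -map_cat pattern_map //.
rewrite !nth_map0 // (inj_eq piI); congr (_ && _ && _); apply: eq_all => t.
by rewrite !nth_map0 // !(inj_eq piI).
Qed.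

Lemma admissible_map pi k d : injective pi -> pi 0 = 0 -> (forall c, (pi c < 5) = (c < 5)) ->
  admissible k (map pi d) = admissible k d.
Proof.
move=> piI pi0 pi5; rewrite /admissible pattern_map // all_map; congr andb.
by apply: eq_all => c /=; rewrite pi5.
Qed.

Lemma admissible_trajectory k d : admissible k d -> d \in trajectories k.
Proof.
case/andP=> d5 pd; have [l pl dE] := pattern_inverse d5.
rewrite mem_undup dE; apply: (allpairs_f (fun q l => [seq nth 0 (0 :: l) c | c <- q]) pd).
by rewrite mem_permutations.
Qed.

Lemma trajectory_admissible k : all (admissible k) (trajectories k).
Proof. by case: k; vm_compute. Qed.

(** * From the finite checks to arbitrary trajectories *)

Lemma extends0P k c : extends0 k -> c < 5 -> exists2 x, admissible k x & nth 0 x 0 = c.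
Proof.
move=> /allP H c5; have /H/hasP[x xo /eqP xc] : c \in iota 0 5 by rewrite mem_iota.
by exists x => //; apply: (allP (trajectory_admissible k)).
Qed.

(** [pi] carries [d] to its pattern, where the check supplies [x]; [pi'] carries [x] back, [good]
    being invariant under joint renaming. *)
Lemma extends1P k1 k2 d c : extends1 k1 k2 -> admissible k1 d -> c < 5 -> c != nth 0 d 0 ->
  exists x, [/\ admissible k2 x, nth 0 x 0 = c & good d x].
Proof.
move=> H ad c5 cd; have /andP[d5 pd] := ad.
have [pi [pi' [K K' pi0 pi5 dE]]] := pattern_renaming d5.
have piI := can_inj K; have pi'I := can_inj K'.
have pi'0 : pi' 0 = 0 by rewrite -{1}pi0 K.
have pi'5 x : (pi' x < 5) = (x < 5) by rewrite -pi5 K'.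
have /(allP (allP H _ pd)) : pi c \in iota 0 5 by rewrite mem_iota pi5.
rewrite -dE nth_map0 // (inj_eq piI) (negbTE cd) => /hasP[x xo /andP[/eqP xc gx]].
exists (map pi' x); split.
- by rewrite admissible_map //; apply: (allP (trajectory_admissible k2)).
- by rewrite nth_map0 // xc K.
- by rewrite -(good_map _ _ piI pi0) -map_comp (eq_map K') map_id.
Qed.

Lemma extends2P k1 k2 k3 d e c : extends2 k1 k2 k3 ->
  admissible k1 d -> admissible k2 e -> good d e -> c < 5 ->
  c != nth 0 d 0 -> c != nth 0 e 0 ->
  exists x, [/\ admissible k3 x, nth 0 x 0 = c, good d x & good e x].
Proof.
move=> H ad ae gde c5 cd ce; have /andP[d5 pd] := ad.
have [pi [pi' [K K' pi0 pi5 dE]]] := pattern_renaming d5.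
have piI := can_inj K; have pi'I := can_inj K'.
have pi'0 : pi' 0 = 0 by rewrite -{1}pi0 K.
have pi'5 x : (pi' x < 5) = (x < 5) by rewrite -pi5 K'.
have eo : map pi e \in trajectories k2 by apply: admissible_trajectory; rewrite admissible_map.
have := allP (allP H _ pd) _ eo; rewrite -dE good_map // gde => /allP/(_ (pi c)).
rewrite mem_iota pi5 => /(_ c5); rewrite !nth_map0 // !(inj_eq piI) (negbTE cd) (negbTE ce).
case/hasP=> x; rewrite mem_filter => /andP[gdx xo] /andP[/eqP xc gex].
exists (map pi' x); split.
- by rewrite admissible_map //; apply: (allP (trajectory_admissible k3)).
- by rewrite nth_map0 // xc K.
- by rewrite -(good_map _ _ piI pi0) -map_comp (eq_map K') map_id.
- by rewrite -(good_map _ _ piI pi0) -map_comp (eq_map K') map_id.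
Qed.

(** Entry 5 is the color after the fifth sweep: this is what the sweeps achieve on the forest. *)
Lemma forest_avoids0 d : admissible false d -> nth 0 d 5 != 0.
Proof.
move/admissible_trajectory; have : all (fun d => nth 0 d 5 != 0) (trajectories false) by vm_compute.
by move/allP; apply.
Qed.

Lemma goodP d e t : good d e -> t < 5 ->
  (nth 0 e t.+1 != nth 0 d t) && (nth 0 e t.+1 != nth 0 d t.+1).
Proof. by case/andP=> /andP[_ /allP H] _ t5; apply: H; rewrite mem_iota. Qed.

Lemma extends0_all k : extends0 k.
Proof. by case: k; lazy. Qed.

Lemma extends1_all k1 k2 : ~~ (k1 && k2) -> extends1 k1 k2.
Proof. by case: k1 k2 => -[]. Qed.

(** In a triangle exactly one vertex lies in class 0, which fixes the third flag. The allowed cases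
    are settled by evaluation. *)
Lemma extends2_all k1 k2 : ~~ (k1 && k2) -> extends2 k1 k2 (~~ k1 && ~~ k2).
Proof. by case: k1 k2 => -[]. Qed.

(** * Sweeps *)

Lemma exists_notin n (s : seq 'I_n) : size s < n -> exists c, c \notin s.
Proof.
move=> lt; case: (pickP [pred c | c \notin s]) => [c|none]; first by exists c.
suff : n <= size s by rewrite leqNgt lt.
rewrite -{1}(card_ord n); apply: leq_trans (card_size s); apply/subset_leq_card/subsetP=> c _.
by move/negbT: (none c); rewrite /= negbK.
Qed.

Section Sweeps.
Variables (V : finType) (e h : rel V) (r : V -> nat).
Hypotheses (eS : symmetric e) (eI : irreflexive e) (eh : subrel e h).
Hypothesis order : elimination_order 2 r h.
Implicit Types f g : coloring V 5.

Let rI : injective r. Proof. by case: order. Qed.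

Definition proper_for_older f : Prop := forall u x, h u x -> r u < r x -> f x != f u.

(** The constraints come from [h] although walks need only be legal for [e]: thus [g] is proper on
    [h] even if [f] is not. *)
Definition swept f g : Prop :=
  forall u x, h u x -> r u < r x -> (g x != f u) && (g x != g u).

Lemma swept_proper f g : swept f g -> proper_for_older g.
Proof. by move=> s u x hux rux; case/andP: (s u x hux rux). Qed.

Lemma proper_for_older_col f : proper_for_older f -> proper_col e f.
Proof.
move=> pf; apply/proper_colP=> x y exy.
case: (ltngtP (r x) (r y)) => [lt|lt|/rI E]; last by rewrite E eI in exy.
  by rewrite eq_sym; apply: pf; first exact: eh.
by apply: pf => //; apply: eh; rewrite eS.
Qed.

Lemma recolorable_swept f g : proper_col e f -> swept f g -> recolorable e 1 f g.
Proof.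
by move=> pf s; apply: (recolorable_sweep rI eS eI pf) => u x rux /eh hux; apply: s.
Qed.

Lemma exists_swept f : exists g, swept f g.
Proof.
(* A state pairs the old color with the new one; only the second is chosen. *)
have [||||t [t1 tg]] := @older_first_choice V r h ('I_5 * 'I_5)%type
  (fun x s => s.1 = f x) (fun a b => (b.2 != a.1) && (b.2 != a.2)).
- exact: order.
- by move=> x; exists (f x, f x).
- move=> u x a _ _ _; have [|c] := @exists_notin 5 [:: a.1; a.2] => //.
  by rewrite !inE negb_or => nc; exists (f x, c).
- move=> u w x a b _ _ _ _ _ _ _ _.
  have [|c] := @exists_notin 5 [:: a.1; a.2; b.1; b.2] => //.
  rewrite !inE !negb_or => /and4P[c1 c2 c3 c4]; exists (f x, c); split=> //=; exact/andP.
exists [ffun x => (t x).2] => u x hux rux; rewrite !ffunE.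
by have := tg u x hux rux; rewrite (t1 u).
Qed.

Lemma exists_classes :
  exists cls : V -> 'I_3, forall u x, h u x -> r u < r x -> cls x != cls u.
Proof.
have [||||cls [_ H]] := @older_first_choice V r h 'I_3 (fun _ _ => True) (fun a b => b != a).
- exact: order.
- by exists ord0.
- move=> u x a _ _ _; have [|c] := @exists_notin 3 [:: a] => //.
  by rewrite inE; exists c.
- move=> u w x a b _ _ _ _ _ _ _ _; have [|c] := @exists_notin 3 [:: a; b] => //.
  by rewrite !inE negb_or => /andP[ca cb]; exists c.
by exists cls.
Qed.

(** * Expelling color 0 and reaching the class coloring *)

Variable cls : V -> 'I_3.
Hypothesis clsP : forall u x, h u x -> r u < r x -> cls x != cls u.

(** The three vertices form a triangle of [h], so their classes are 0, 1, 2 in some order. *)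
Lemma third_class u w x : h u w -> r u < r w -> h u x -> h w x -> r w < r x ->
  (cls x == ord0) = (cls u != ord0) && (cls w != ord0).
Proof.
move=> huw ruw hux hwx rwx.
have := clsP huw ruw; have := clsP hux (ltn_trans ruw rwx); have := clsP hwx rwx.
by case: (cls u) (cls w) (cls x) => [[|[|[|//]]] ?] [[|[|[|//]]] ?] [[|[|[|//]]] ?].
Qed.

Lemma forest_loses_color0 f : proper_for_older f ->
  exists g, [/\ recolorable e 5 f g, proper_for_older g &
                forall x, cls x != ord0 -> g x != ord0].
Proof.
move=> pf; pose k x := cls x == ord0.
(* A state is a whole trajectory starting at [f x], so the five sweeps are chosen together. *)
have [||||t [tok tg]] := @older_first_choice V r h (seq nat)
  (fun x s => admissible (k x) s /\ nth 0 s 0 = f x) good.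
- exact: order.
- by move=> x; have [s ? ?] := extends0P (extends0_all (k x)) (ltn_ord (f x)); exists s.
- move=> u x a hux rux [adm a0].
  have [||s [? ? ?]] := @extends1P (k u) (k x) a (f x) _ adm (ltn_ord _).
  + apply: extends1_all; apply/negP => /andP[/eqP ku /eqP kx].
    by have := clsP hux rux; rewrite ku kx.
  + by rewrite a0; apply: pf.
  by exists s.
- move=> u w x a b huw hux hwx ruw rwx [adma a0] [admb b0] gab.
  have ext : extends2 (k u) (k w) (k x).
    rewrite /k (third_class huw ruw hux hwx rwx); apply: extends2_all.
    by apply/negP => /andP[/eqP ku /eqP kw]; have := clsP huw ruw; rewrite ku kw.
  have [||s [? ? ? ?]] := extends2P ext adma admb gab (ltn_ord (f x)).
  + by rewrite a0; apply: pf => //; apply: ltn_trans rwx.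
  + by rewrite b0; apply: pf.
  by exists s.
pose g n : coloring V 5 := [ffun x => inord (nth 0 (t x) n)].
have gE n x : g n x = nth 0 (t x) n :> nat.
  rewrite ffunE inordK //; have [/andP[/all_nthP t5 _] _] := tok x.
  by have [lt|ge] := ltnP n (size (t x)); [exact: (t5 0 n lt) | rewrite nth_default].
have g0 : g 0 = f by apply/ffunP=> x; apply: ord_inj; rewrite gE; case: (tok x).
have gs n : n < 5 -> swept (g n) (g n.+1).
  by move=> n5 u x hux rux; have := goodP (tg u x hux rux) n5; rewrite -!gE -!val_eqE.
have gp n : n < 6 -> proper_for_older (g n).
  by case: n => [|n] n5; [rewrite g0 | apply: swept_proper (gs n n5)].
have gr n : n < 6 -> recolorable e n (g 0) (g n).
  elim: n => [|n IH] n5; first exact: recolorable_refl.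
  have st : recolorable e 1 (g n) (g n.+1).
    by apply: recolorable_swept (gs n n5); apply/proper_for_older_col/gp/ltnW.
  by have := recolorable_trans (IH (ltnW n5)) st; rewrite addn1.
exists (g 5); split; [by rewrite -g0; apply: gr | exact: gp |].
move=> x fx; have : nth 0 (t x) 5 != 0.
  by apply: forest_avoids0; have [] := tok x; rewrite /k (negbTE fx).
by rewrite -gE -val_eqE.
Qed.

Definition class_color : coloring V 5 := [ffun x => widen_ord (isT : 3 <= 5) (cls x)].

(** Three sweeps: class 0 takes color 0, the forest moves into [range], then every vertex takes its
    class color. In the second, an older forest neighbor forbids at most two of the three colors of
    a forest vertex. *)
Lemma recolorable_class_color f : proper_for_older f ->
  (forall x, cls x != ord0 -> f x != ord0) -> recolorable e 3 f class_color.
Proof.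
move=> pf f0.
pose f1 : coloring V 5 := [ffun x => if cls x == ord0 then ord0 else f x].
have s1 : swept f f1.
  move=> u x hux rux; have cl := clsP hux rux; have E := pf u x hux rux; rewrite !ffunE.
  have [Ex|nx] := eqVneq (cls x) ord0; have [Eu|nu] := eqVneq (cls u) ord0.
  - by rewrite Ex Eu in cl.
  - by rewrite eq_sym f0.
  - by rewrite E f0.
  - by rewrite E.
have f10 x : cls x != ord0 -> f1 x != ord0 by move=> nx; rewrite ffunE (negbTE nx) f0.
(* With forest colors in [range], no vertex holds the class color of a neighbor,
   so that the last sweep can move every vertex to its class color. *)
pose range x : seq 'I_5 :=
  if cls x == ord0 then [:: ord0] else [:: class_color x; inord 3; inord 4].
pose ok x s := s.1 = f1 x /\ s.2 \in range x.
pose free (a b : 'I_5 * 'I_5) := (b.2 != a.1) && (b.2 != a.2).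
have range0 x : cls x != ord0 -> ord0 \notin range x.
  move=> x0; rewrite /range (negbTE x0) !inE !negb_or -!val_eqE /= !inordK // ffunE /= andbT.
  by rewrite eq_sym.
have range_uniq x : cls x != ord0 -> uniq (range x).
  move=> x0; rewrite /range (negbTE x0) /= !inE !negb_or -!val_eqE /= !inordK // ffunE /=.
  by rewrite !andbT; case: (cls x) => -[|[|[]]].
have range_avoid x b : cls x != ord0 -> exists2 s, ok x s & free b s.
  move=> x0; suff /hasP[c cx cb] : has (fun c => (c != b.1) && (c != b.2)) (range x).
    by exists (f1 x, c).
  apply: contraT => /hasPn H; have : size (range x) <= size [:: b.1; b.2].
    apply: uniq_leq_size (range_uniq _ x0) _ => c /H.
    by rewrite negb_and !negbK !inE.
  by rewrite /range (negbTE x0).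
have class0_ok x : cls x == ord0 -> ok x (ord0, ord0).
  by move=> x0; rewrite /ok /range ffunE x0.
have class0_free u a : cls u != ord0 -> ok u a -> free a (ord0, ord0).
  move=> u0 [a1 a2]; rewrite /free /= eq_sym a1 f10 //.
  by apply: contraNneq (range0 _ u0) => ->.
have forest_free u x a s : cls u == ord0 -> cls x != ord0 -> ok u a -> ok x s -> free a s.
  move=> u0 x0 [a1 a2] [s1' s2']; rewrite /free a1 ffunE u0.
  have -> : a.2 = ord0 by apply/eqP; move: a2; rewrite /range u0 inE.
  by rewrite andbb; apply: contraNneq (range0 _ x0) => <-.
have [||||t [tok tg]] := @older_first_choice V r h ('I_5 * 'I_5)%type ok free.
- exact: order.
- move=> x; exists (f1 x, head ord0 (range x)); split=> //=.
  by rewrite /range; case: ifP; rewrite inE eqxx.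
- move=> u x a hux rux oka; have [x0|x0] := boolP (cls x == ord0).
    exists (ord0, ord0); first exact: class0_ok.
    by apply: class0_free oka; apply: contraTneq (clsP hux rux) => ->; rewrite negbK.
  exact: range_avoid.
- move=> u w x a b huw hux hwx ruw rwx oka okb _; have := third_class huw ruw hux hwx rwx.
  have [x0 /esym/andP[u0 w0]|x0] := boolP (cls x == ord0).
    exists (ord0, ord0); split; [exact: class0_ok|exact: class0_free oka|exact: class0_free okb].
  (* Of the two older neighbors of a forest vertex, one is in class 0, so only the other restricts
     the choice. *)
  have [u0 _|u0 /esym/negbFE w0] := boolP (cls u == ord0).
    have [s oks fs] := range_avoid x b x0; exists s; split=> //; exact: forest_free oka oks.
  have [s oks fs] := range_avoid x a x0; exists s; split=> //; exact: forest_free okb oks.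
pose f2 : coloring V 5 := [ffun x => (t x).2].
have s2 : swept f1 f2.
  move=> u x hux rux; rewrite !ffunE; have := tg u x hux rux.
  by rewrite /free; case: (tok u) => ->; rewrite ffunE.
have s3 : swept f2 class_color.
  move=> u x hux rux; have cl := clsP hux rux; rewrite !ffunE -!val_eqE /=.
  rewrite val_eqE cl andbT; have [_] := tok u; rewrite /range; case: ifP => [/eqP u0|_].
    by rewrite inE => /eqP ->; rewrite u0 in cl.
  rewrite !inE ffunE -!val_eqE /= !inordK // => /or3P[]/eqP ->; rewrite ?cl //.
    by rewrite neq_ltn ltn_ord.
  by rewrite neq_ltn (ltn_trans (ltn_ord _)).
have r1 := recolorable_swept (proper_for_older_col pf) s1.
have r2 := recolorable_swept (proper_for_older_col (swept_proper s1)) s2.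
have r3 := recolorable_swept (proper_for_older_col (swept_proper s2)) s3.
exact: recolorable_trans r1 (recolorable_trans r2 r3).
Qed.

(** One sweep makes the coloring proper on [h], five expel color 0 from the forest, three reach the
    class coloring. *)
Lemma recolorable_to_class_color f : proper_col e f -> recolorable e 9 f class_color.
Proof.
move=> pf; have [g sg] := exists_swept f.
have [g' [r' pg' g'0]] := forest_loses_color0 (swept_proper sg).
have r1 := recolorable_swept pf sg; have r3 := recolorable_class_color pg' g'0.
exact: recolorable_trans r1 (recolorable_trans r' r3).
Qed.

End Sweeps.

(* A transformation from alpha to beta is the walk alpha :: s, with all
   colorings proper, consecutive ones adjacent, and last element beta. *)
Theorem theorem1 :
  exists c : nat,
    forall (V : finType) (e : rel V),
      simple_graph e -> treewidth_le e 2 ->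
      forall alpha beta : coloring V 5,
        proper_col e alpha -> proper_col e beta ->
        exists s : seq (coloring V 5),
          [/\ path (@adj_col V 5) alpha s,
              all (fun f => proper_col e f) s,
              last alpha s = beta &
              forall v : V, recolor_count v (alpha :: s) <= c].
Proof.
(* Nine recolorings from [alpha] to the class coloring, nine more along the reversed walk to
   [beta]. *)
exists 18 => V e [eS eI] tw alpha beta pa pb.
have [r [h [order eh]]] := treewidth_elimination_order eI tw.
have [cls clsP] := exists_classes order.
have to_class := recolorable_to_class_color eS eI eh order clsP.
exact: recolorable_trans (to_class _ pa) (recolorable_sym pb (to_class _ pb)).
Qed.
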